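(* Let $P$, $Q$, and $R$ be problems. Then $R$ is computably reducible to $Q$ followed by $P$ if and only if $R \leq_c P *_c Q$.
   Context: A problem $P : \subseteq \omega^\omega \rightrightarrows \omega^\omega$ is a partial multi-function taking $\omega$-valued sequences to sets of $\omega$-valued sequences: it has a domain $\mathrm{dom}(P) \subseteq \omega^\omega$, whose elements are called the instances of $P$ (or $P$-instances), and to each $X \in \mathrm{dom}(P)$ it assigns a set $P(X) \subseteq \omega^\omega$, whose elements are called the $P$-solutions of $X$. Write $\leq_T$ for Turing reducibility and $\oplus$ for the Turing join. Computable reducibility: for problems $P$ and $Q$, $P \leq_c Q$ means that for every $X \in \mathrm{dom}(P)$ there is $\widehat{X} \in \mathrm{dom}(Q)$ with $\widehat{X} \leq_T X$ such that for every $\widehat{Y} \in Q(\widehat{X})$ there is $Y \in P(X)$ with $Y \leq_T X \oplus \widehat{Y}$. For problems $P$, $Q$, $R$, we say that $R$ is computably reducible to $Q$ followed by $P$ if for every $R$-instance $X$ there is a $Q$-instance $\widehat{X} \leq_T X$ such that for every $Q$-solution $\widehat{Y}$ of $\widehat{X}$ there is a $P$-instance $Z \leq_T X \oplus \widehat{Y}$ such that for every $P$-solution $W$ of $Z$ there is an $R$-solution $Y$ of $X$ with $Y \leq_T X \oplus \widehat{Y} \oplus W$. Composition: for problems $P$ and $Q$, $P \circ Q$ is the problem whose instances are those $X \in \mathrm{dom}(Q)$ such that every $Y \in Q(X)$ satisfies $Y \in \mathrm{dom}(P)$; the $(P \circ Q)$-solutions of such an $X$ are all $Z$ such that there exists $Y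 \in Q(X)$ with $Z \in P(Y)$. For problems $P$ and $Q$, $P *_c Q$ denotes the collection of compositions $P *_c Q = \{P' \circ Q' : P' \leq_c P \text{ and } Q' \leq_c Q\}$, where $P'$ and $Q'$ range over problems. For a problem $R$, $R \leq_c P *_c Q$ means that there is $(P' \circ Q') \in P *_c Q$ such that $R \leq_c P' \circ Q'$. *)

(* Defs.v *)
From mathcomp Require Import all_boot.

Set Implicit Arguments.
Unset Strict Implicit.
Unset Printing Implicit Defensive.

Definition baire := nat -> nat.

(* A partial function from k.-tuple nat to nat, represented by its graph. *)
Definition pfun (k : nat) := k.-tuple nat -> nat -> Prop.

(* The partial functions that are recursive relative to the oracle X: the least
   class containing the basic functions and X, and closed under composition,
   primitive recursion and (unbounded) minimization.  The functions are given
   by their graphs, hence the closure under equality of graphs in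
   [rec_ext]. *)
Inductive rec_in (X : baire) : forall k : nat, pfun k -> Prop :=
| rec_ext k (F G : pfun k) :
    (forall v y, F v y <-> G v y) -> rec_in X F -> rec_in X G
| rec_zero k : rec_in X (fun (_ : k.-tuple nat) y => y = 0)
| rec_succ : rec_in X (fun (v : 1.-tuple nat) y => y = (thead v).+1)
| rec_proj k (i : 'I_k) : rec_in X (fun (v : k.-tuple nat) y => y = tnth v i)
| rec_oracle : rec_in X (fun (v : 1.-tuple nat) y => y = X (thead v))
| rec_comp k m (F : pfun m) (G : 'I_m -> pfun k) :
    rec_in X F -> (forall i, rec_in X (G i)) ->
    rec_in X (fun v y =>
      exists w : m.-tuple nat, (forall i, G i v (tnth w i)) /\ F w y)
(* h is the course of values: h 0 = F v and h (i+1) = G (i, h i, v). *)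
| rec_prim k (F : pfun k) (G : pfun k.+2) :
    rec_in X F -> rec_in X G ->
    rec_in X (fun (v : k.+1.-tuple nat) y =>
      exists h : nat -> nat,
        [/\ F [tuple of behead v] (h 0),
            forall i, i < thead v ->
              G [tuple of i :: h i :: behead v] (h i.+1)
          & y = h (thead v)])
(* The search for the least zero requires F to be defined and nonzero at all
   smaller arguments. *)
| rec_min k (F : pfun k.+1) :
    rec_in X F ->
    rec_in X (fun (v : k.-tuple nat) y =>
      F [tuple of y :: v] 0 /\
      forall i, i < y -> exists z, F [tuple of i :: v] z.+1).

Definition turing_le (Y X : baire) : Prop :=
  rec_in X (fun (v : 1.-tuple nat) y => y = Y (thead v)).

Definition join (X Y : baire) : baire :=
  fun n => if odd n then Y n./2 else X n./2.

Declare Scope problem_scope.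
Delimit Scope problem_scope with problem.
Notation "Y <=T X" := (turing_le Y X) (at level 70) : problem_scope.
Notation "X (+T) Y" := (join X Y) (at level 50, left associativity)
  : problem_scope.
Local Open Scope problem_scope.

(* An instance may have no solution: [dom] is part of the data, and it need not
   be the set of X such that [sol X] is nonempty. *)
Record problem := Problem {
  dom : baire -> Prop;
  sol : baire -> baire -> Prop;
  sol_dom : forall X Y, sol X Y -> dom X
}.

Definition computably_reducible (P Q : problem) : Prop :=
  forall X, dom P X ->
  exists X', [/\ dom Q X', X' <=T X &
    forall Y', sol Q X' Y' -> exists Y, sol P X Y /\ Y <=T X (+T) Y'].

Notation "P <=c Q" := (computably_reducible P Q) (at level 70)
  : problem_scope.

Definition reducible_to_followed_by (R Q P : problem) : Prop :=
  forall X, dom R X ->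
  exists X', [/\ dom Q X', X' <=T X &
    forall Y', sol Q X' Y' ->
    exists Z, [/\ dom P Z, Z <=T X (+T) Y' &
      forall W, sol P Z W ->
      exists Y, sol R X Y /\ Y <=T X (+T) Y' (+T) W]].

Definition comp_dom (P Q : problem) (X : baire) : Prop :=
  dom Q X /\ forall Y, sol Q X Y -> dom P Y.

Definition comp_sol (P Q : problem) (X Z : baire) : Prop :=
  comp_dom P Q X /\ exists Y, sol Q X Y /\ sol P Y Z.

Lemma comp_sol_dom P Q X Z : comp_sol P Q X Z -> comp_dom P Q X.
Proof. by case. Qed.

Definition comp_problem (P Q : problem) : problem :=
  Problem (@comp_sol_dom P Q).

Definition compositional_product (P Q : problem) : problem -> Prop :=
  fun S => exists P' Q', [/\ P' <=c P, Q' <=c Q & S = comp_problem P' Q'].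

Notation "P *c Q" := (compositional_product P Q) (at level 40)
  : problem_scope.

Definition reducible_to_class (R : problem) (C : problem -> Prop) : Prop :=
  exists S, C S /\ R <=c S.

(* Main.v *)
Require Import Defs.
From mathcomp Require Import all_boot.
From Stdlib Require Import FunctionalExtensionality.

(** Forward direction: let Q' send an R-instance X to the joins X (+T) Y' for
    which the second half of the reduction succeeds, and let P' send such a join
    directly to the R-solutions of its left half X.  All computational content
    then sits in the two reductions of Q' to Q and of P' to P.  Conversely, the
    three reductions witnessing R <=c P' o Q', Q' <=c Q and P' <=c P chain
    together, because the Turing join is a least upper bound for <=T. *)

Local Open Scope problem_scope.

(** For total functions, closure under the recursion schemes becomes equational. [Y <=T X] is by
    conversion the unary case, so these closure lemmas apply directly to Turing reductions. *)
Definition total_rec_in (X : baire) (k : nat) (f : k.-tuple nat -> nat) : Prop :=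
  rec_in X (fun v y => y = f v).

Lemma total_rec_in_ext X k (f g : k.-tuple nat -> nat) :
  f =1 g -> total_rec_in X k f -> total_rec_in X k g.
Proof. by move=> fg; apply: rec_ext => v y; rewrite fg. Qed.

Lemma total_rec_in_comp X k m (f : m.-tuple nat -> nat)
    (g : 'I_m -> k.-tuple nat -> nat) :
  total_rec_in X m f -> (forall i, total_rec_in X k (g i)) ->
  total_rec_in X k (fun v => f [tuple g i v | i < m]).
Proof.
move=> rf rg; apply: rec_ext (rec_comp rf rg) => v y; split=> [[w [gw ->]]|->].
  by congr f; apply: eq_from_tnth => i; rewrite tnth_mktuple gw.
by exists [tuple g i v | i < m]; split=> // i; rewrite tnth_mktuple.
Qed.

Lemma total_rec_in_comp1 X k (f : nat -> nat) (g : k.-tuple nat -> nat) :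
  total_rec_in X 1 (fun v => f (thead v)) -> total_rec_in X k g ->
  total_rec_in X k (fun v => f (g v)).
Proof.
move=> rf rg; apply: total_rec_in_ext (total_rec_in_comp _ _ _ _ (fun=> g) rf _) => //.
by move=> v; rewrite /thead tnth_mktuple.
Qed.

Lemma total_rec_in_const X k c : total_rec_in X k (fun=> c).
Proof.
elim: c => [|c IHc]; first exact: rec_zero.
exact: total_rec_in_comp1 (rec_succ X) IHc.
Qed.

Lemma total_rec_in_prim X k (f : k.-tuple nat -> nat)
    (g : k.+2.-tuple nat -> nat) :
  total_rec_in X k f -> total_rec_in X k.+2 g ->
  total_rec_in X k.+1 (fun v => nat_rect (fun=> nat) (f [tuple of behead v])
    (fun i h => g [tuple of i :: h :: behead v]) (thead v)).
Proof.
move=> rf rg; apply: rec_ext (rec_prim rf rg) => v y; split=> [[h [h0 hS ->]]|->].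
  (* The bound on the right stays fixed during the induction, because [hS] is available only below
     [thead v]. *)
  have: thead v <= thead v by [].
  elim: {1 3 4}(thead v) => [|i IHi] lti //=.
  by rewrite -IHi 1?ltnW // hS.
(* Unification takes the [nat_rect] itself as the course of values. *)
by eexists; split; last reflexivity.
Qed.

(** Branching is primitive recursion on the value of [a], with parameters [b v] and [c v]: the base
    case returns the first, every step returns the second. *)
Lemma total_rec_in_if X k (a b c : k.-tuple nat -> nat) :
  total_rec_in X k a -> total_rec_in X k b -> total_rec_in X k c ->
  total_rec_in X k (fun v => if a v == 0 then b v else c v).
Proof.
move=> ra rb rc.
pose g (i : 'I_3) := tnth [tuple a; b; c] i.
have rprim := total_rec_in_prim X 2 _ _
  (rec_proj X (ord0 : 'I_2)) (rec_proj X (ord_max : 'I_4)).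
apply: total_rec_in_ext (total_rec_in_comp X k _ _ g rprim _).
  move=> v; have -> : [tuple g i v | i < 3] = [tuple a v; b v; c v].
    by apply: eq_from_tnth => i; rewrite tnth_mktuple; case: i => [[|[|[|]]] lti].
  by rewrite theadE; case: (a v).
by case=> [[|[|[|]]] lti].
Qed.

Lemma total_rec_in_rec X (c : nat) (g : nat -> nat -> nat) :
  total_rec_in X 2 (fun v => g (tnth v ord0) (tnth v ord_max)) ->
  total_rec_in X 1 (fun v => nat_rect (fun=> nat) c g (thead v)).
Proof.
move=> rg; apply: total_rec_in_ext (total_rec_in_prim X 0 _ _ (total_rec_in_const X 0 c) rg).
by move=> v /=; elim: (thead v) => //= n ->; rewrite !(tnth_nth 0).
Qed.

Lemma total_rec_in_odd X : total_rec_in X 1 (fun v => odd (thead v)).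
Proof.
apply: total_rec_in_ext (total_rec_in_rec X 0 (fun _ h => if h == 0 then 1 else 0) _).
  by move=> v; elim: (thead v) => //= n ->; case: odd.
by apply: total_rec_in_if; [exact: rec_proj | exact: total_rec_in_const..].
Qed.

Lemma total_rec_in_half X : total_rec_in X 1 (fun v => (thead v)./2).
Proof.
apply: total_rec_in_ext (total_rec_in_rec X 0
  (fun i h => if odd i == 0 :> nat then h else h.+1) _).
  by move=> v; elim: (thead v) => //= n ->; rewrite uphalf_half; case: odd.
apply: total_rec_in_if; last 2 [exact: rec_proj].
- exact: total_rec_in_comp1 (fun n => odd n) _ (total_rec_in_odd X) (rec_proj X ord0).
- exact: total_rec_in_comp1 (rec_succ X) (rec_proj X ord_max).
Qed.

Lemma total_rec_in_double X : total_rec_in X 1 (fun v => (thead v).*2).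
Proof.
apply: total_rec_in_ext (total_rec_in_rec X 0 (fun _ h => h.+2) _).
  by move=> v; elim: (thead v) => //= n ->.
apply: total_rec_in_comp1 (rec_succ X) _.
exact: total_rec_in_comp1 (rec_succ X) (rec_proj X ord_max).
Qed.

Lemma turing_le_refl X : X <=T X.
Proof. exact: rec_oracle. Qed.

(** By induction on the derivation of [X] from [Y]: each rule is replayed over [Z], and a call to
    the oracle [Y] becomes the derivation [YZ]. *)
Lemma turing_le_trans Y X Z : X <=T Y -> Y <=T Z -> X <=T Z.
Proof.
move=> XY YZ; rewrite /turing_le; elim: XY => //.
- by move=> k F G FG _; apply: rec_ext.
- exact: rec_zero.
- exact: rec_succ.
- exact: rec_proj.
- by move=> k m F G _ rF _; apply: rec_comp.
- by move=> k F G _ rF _; apply: rec_prim.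
- by move=> k F _; apply: rec_min.
Qed.

Lemma turing_le_joinl X Y : X <=T X (+T) Y.
Proof.
apply: total_rec_in_ext
  (total_rec_in_comp1 _ _ _ _ (rec_oracle _) (total_rec_in_double _)) => v.
by rewrite /join odd_double doubleK.
Qed.

Lemma turing_le_joinr X Y : Y <=T X (+T) Y.
Proof.
apply: total_rec_in_ext (total_rec_in_comp1 _ _ _ _ (rec_oracle _)
  (total_rec_in_comp1 _ _ _ _ (rec_succ _) (total_rec_in_double _))) => v.
by rewrite /join /= odd_double /= uphalf_double.
Qed.

Lemma turing_le_join X Y Z : X <=T Z -> Y <=T Z -> X (+T) Y <=T Z.
Proof.
move=> XZ YZ.
have half := total_rec_in_half Z.
apply: total_rec_in_ext (total_rec_in_if _ _ _ _ _ (total_rec_in_odd Z)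
  (total_rec_in_comp1 _ _ _ _ XZ half) (total_rec_in_comp1 _ _ _ _ YZ half)) => v.
by rewrite /join; case: odd.
Qed.

Definition left_half (V : baire) : baire := fun n => V n.*2.

Lemma left_half_join X Y : left_half (X (+T) Y) = X.
Proof.
apply: functional_extensionality => n.
by rewrite /left_half /join odd_double doubleK.
Qed.

Section Forward.
Variables P R : problem.

(** With [V] a join of [X] and [Y'], this is what the second half of the reduction supplies. Placing
    [Z] in the domain condition makes the reduction to [P] immediate. *)
Definition second_dom (V : baire) : Prop :=
  exists Z, [/\ dom P Z, Z <=T V &
    forall W, sol P Z W -> exists Y, sol R (left_half V) Y /\ Y <=T V (+T) W].

Definition second_sol (V Y : baire) : Prop :=
  second_dom V /\ sol R (left_half V) Y.

Definition second_problem : problem :=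
  Problem (fun V Y (s : second_sol V Y) => proj1 s).

(** Requiring [second_dom V] makes each solution an instance of the second problem, so the
    composition is defined on all of [dom R]. *)
Definition first_sol (X V : baire) : Prop :=
  dom R X /\ exists Y', V = X (+T) Y' /\ second_dom V.

Definition first_problem : problem :=
  Problem (fun X V (s : first_sol X V) => proj1 s).

Lemma second_problem_reducible : second_problem <=c P.
Proof.
move=> V Vdom; have [Z [PZ ZV solZ]] := Vdom.
by exists Z; split=> // W /solZ [Y [RY YVW]]; exists Y.
Qed.

Lemma first_problem_reducible Q :
  reducible_to_followed_by R Q P -> first_problem <=c Q.
Proof.
move=> red X RX; have [X' [QX' X'X solX']] := red X RX.
exists X'; split=> // Y' /solX' secondY'; exists (X (+T) Y').
split; last exact: turing_le_refl.
by split=> //; exists Y'; rewrite /second_dom left_half_join.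
Qed.

Lemma reducible_to_comp_problem :
  R <=c comp_problem second_problem first_problem.
Proof.
move=> X RX; exists X; split; last 1 first.
(* The intermediate solution is a join with left half [X], so [Y] already solves [X] for [R]. *)
- move=> Y [_ [_ [[_ [Y' [-> _]]] [_]]]]; rewrite left_half_join => RY.
  by exists Y; split=> //; exact: turing_le_joinr.
- by split=> // V [_ [Y' []]].
- exact: turing_le_refl.
Qed.

End Forward.

Lemma reducible_to_followed_by_comp (P Q R P' Q' : problem) :
  P' <=c P -> Q' <=c Q -> R <=c comp_problem P' Q' ->
  reducible_to_followed_by R Q P.
Proof.
move=> redP redQ redR X /redR [X1 [X1dom X1X solX1]].
have [QX1 PX1] := X1dom.
have [X' [QX' X'X1 solX']] := redQ _ QX1.
exists X'; split=> //; first exact: turing_le_trans X'X1 X1X.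
move=> Y' /solX' [Y1 [Q'Y1 Y1le]].
have Y1le' : Y1 <=T X (+T) Y'.
  apply: turing_le_trans Y1le _; apply: turing_le_join (turing_le_joinr _ _).
  exact: turing_le_trans X1X (turing_le_joinl _ _).
(* Membership of [X1] in the domain of the composition makes [Y1] an instance of [P']. *)
have [Z [PZ ZY1 solZ]] := redP _ (PX1 _ Q'Y1).
exists Z; split=> //; first exact: turing_le_trans ZY1 Y1le'.
move=> W /solZ [V [P'V Vle]].
have [|Y [RY Yle]] := solX1 V; first by split=> //; exists Y1.
exists Y; split=> //; apply: turing_le_trans Yle _.
(* It remains to bound [X (+T) V], where [V <=T Y1 (+T) W] and [Y1 <=T X (+T) Y']. *)
have XY'le := turing_le_joinl (X (+T) Y') W.
apply: turing_le_join.
  exact: turing_le_trans (turing_le_joinl _ _) XY'le.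
apply: turing_le_trans Vle _; apply: turing_le_join (turing_le_joinr _ _).
exact: turing_le_trans Y1le' XY'le.
Qed.

Theorem proposition3p1 (P Q R : problem) :
  reducible_to_followed_by R Q P <-> reducible_to_class R (P *c Q).
Proof.
split=> [red|[_ [[P' [Q' [redP redQ ->]]]]]]; last first.
  exact: reducible_to_followed_by_comp.
exists (comp_problem (second_problem P R) (first_problem P R)).
split; last exact: reducible_to_comp_problem.
exists (second_problem P R), (first_problem P R); split=> //.
- exact: second_problem_reducible.
- exact: first_problem_reducible.
Qed.
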